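(* Let $\mu_0\in\mathbb{W}_2(\mathbb{R}^m)$ be discrete. (1) Given $\{\theta_i\}_{i=1}^N\subset\Theta\subset\mathbb{R}^m$ and the corresponding measures $\{\mu_{\theta_i}\}_{i=1}^N\subset\mathcal{M}^{\mathrm{trans}}(\mu_0,\Theta)$, the Discrete Wassmap algorithm with exponent $2$ and embedding dimension $m$, applied to $\{\mu_{\theta_i}\}_{i=1}^N$, recovers $\{\theta_i\}_{i=1}^N$ up to rigid transformation. (2) Given $\{\theta_i\}_{i=1}^N\subset\Theta\subset\mathbb{R}^m_+$ and the corresponding measures $\{\mu_{\theta_i}\}_{i=1}^N\subset\mathcal{M}^{\mathrm{dil}}(\mu_0,\Theta)$, the Discrete Wassmap algorithm with exponent $2$ and embedding dimension $m$, applied to $\{\mu_{\theta_i}\}_{i=1}^N$, recovers $\{S\theta_i\}_{i=1}^N$ up to rigid transformation, where $S=\mathrm{diag}\big(M_2^{1/2}(P_1\mu_0),\dots,M_2^{1/2}(P_m\mu_0)\big)$.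
   Context: $\mathbb{W}_2(\mathbb{R}^m)$ is the set of Borel probability measures $\mu$ on $\mathbb{R}^m$ with $\int|x|^2\,d\mu<\infty$, with the $2$-Wasserstein distance $W_2(\mu,\nu)=\inf_{\gamma}\left(\int_{\mathbb{R}^{2m}}|x-y|^2\,d\gamma(x,y)\right)^{1/2}$, the infimum being over all couplings $\gamma$ of $\mu$ and $\nu$; $|\cdot|$ is the Euclidean norm. A measure is discrete if it is a (finite or countable) combination of Dirac masses. $\mathcal{M}^{\mathrm{trans}}(\mu_0,\Theta)=\{\mu_\theta:\theta\in\Theta\}$ where $\mu_\theta=\mu_0(\cdot-\theta)$ is the pushforward of $\mu_0$ under $x\mapsto x+\theta$. $\mathbb{R}^m_+$ is the set of vectors $\theta=(\vartheta_1,\dots,\vartheta_m)$ with all $\vartheta_i>0$; $D_\theta=\mathrm{diag}(1/\vartheta_1,\dots,1/\vartheta_m)$; $\mathcal{M}^{\mathrm{dil}}(\mu_0,\Theta)=\{\mu_\theta:\theta\in\Theta\}$ where $\mu_\theta$ is the pushforward of $\mu_0$ under $x\mapsto D_\theta^{-1}x=(\vartheta_1x_1,\dots,\vartheta_mx_m)$. $P_i\mu$ is the $i$-th one-dimensional marginal of $\mu$ and $M_2(P_i\mu)=\int_{\mathbb{R}^m}|x_i|^2\,d\mu(x)$. Discrete Wassmap algorithm (exponent $p$, embedding dimension $d$), with discrete probability measures as input. Input: $\mu_1,\dots,\mu_N\in\mathbb{W}_p(\mathbb{R}^m)$ discrete. (1) Form the $N\times N$ matrix $W$ with $W_{ij}=W_p(\mu_i,\mu_j)^2$.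 (2) Set $B=-\tfrac12 HWH$ with $H=I-\tfrac1N\mathbb{1}_N$, where $\mathbb{1}_N$ is the $N\times N$ all-ones matrix. (3) Take the truncated eigendecomposition $B_d=V_d\Lambda_dV_d^T$, where $\Lambda_d$ is the diagonal matrix of the $d$ largest eigenvalues of $B$ and the columns of $V_d$ are corresponding orthonormal eigenvectors (if $d>N$, pad with zero columns). (4) Output $z_i=$ the $i$-th row of $V_d\Lambda_d^{1/2}$, $i=1,\dots,N$, as points in $\mathbb{R}^d$. The algorithm recovers $\{y_i\}_{i=1}^N\subset\mathbb{R}^d$ up to rigid transformation if the eigenvalues in $\Lambda_d$ are nonnegative and, for any choice of eigenvectors, there is a Euclidean isometry $R(x)=Qx+b$ of $\mathbb{R}^d$ ($Q$ orthogonal) with $z_i=R(y_i)$ for all $i$. *)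

(* Defs.v *)
From HB Require Import structures.
From mathcomp Require Import all_boot all_order all_algebra.
From mathcomp Require Import all_classical all_reals all_analysis.

Set Implicit Arguments.
Unset Strict Implicit.
Unset Printing Implicit Defensive.

Import Order.TTheory GRing.Theory Num.Theory.
Import numFieldNormedType.Exports.

Local Open Scope classical_set_scope.
Local Open Scope ring_scope.

(* R^m with its Borel sigma-algebra; points are row vectors. *)
Notation Rvec R m := (g_sigma_algebraType (@open 'rV[R]_m)).

(* The library norm on matrices is the sup norm, hence this definition. *)
Definition euclid_norm (R : realType) (m : nat) (x : 'rV[R]_m) : R :=
  Num.sqrt (\sum_(i < m) `|x 0 i| ^+ 2).

Definition finite_second_moment (R : realType) (m : nat)
    (mu : probability (Rvec R m) R) : Prop :=
  (\int[mu]_x (euclid_norm (x : 'rV[R]_m) ^+ 2)%:E < +oo)%E.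

(* Finite combinations are covered by zero weights. *)
Definition discrete_measure (R : realType) (m : nat)
    (mu : probability (Rvec R m) R) : Prop :=
  exists (c : nat -> R) (a : nat -> Rvec R m), (forall k, 0 <= c k) /\
    forall A : set (Rvec R m), measurable A ->
      mu A = (\sum_(0 <= k <oo) (c k)%:E * \d_(a k) A)%E.

Definition couplings (R : realType) (m : nat)
    (mu nu : probability (Rvec R m) R) :
    set (probability (Rvec R m * Rvec R m)%type R) :=
  [set gamma | forall A : set (Rvec R m), measurable A ->
     gamma (A `*` setT) = mu A /\ gamma (setT `*` A) = nu A].

Definition W2 (R : realType) (m : nat)
    (mu nu : probability (Rvec R m) R) : \bar R :=
  ereal_inf [set poweR
    (\int[gamma]_z (euclid_norm ((z.1 : 'rV[R]_m) - z.2) ^+ 2)%:E)%E 2^-1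
    | gamma in couplings mu nu].

Section pushforward_maps.
Context (R : realType) (m : nat).

Definition translation (theta : 'rV[R]_m) (x : Rvec R m) : Rvec R m :=
  (x : 'rV[R]_m) + theta.

Definition dilation (theta : 'rV[R]_m) (x : Rvec R m) : Rvec R m :=
  \row_(i < m) (theta 0 i * (x : 'rV[R]_m) 0 i).

Lemma measurable_coordinatewise (f : 'I_m -> R -> R) (F : Rvec R m -> Rvec R m) :
  (forall i, continuous (f i)) ->
  (forall x, F x = \row_i f i ((x : 'rV[R]_m) 0 i)) ->
  measurable_fun setT F.
Proof.
move=> cf FE.
apply: (@measurability _ _ _ _ setT F (@open 'rV[R]_m)) => //.
move=> _ [A oA <-]; rewrite setTI; apply: sub_sigma_algebra.
suff cF : continuous (F : 'rV[R]_m -> 'rV[R]_m).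
  by move/continuousP : cF; exact.
move=> x B [P nP PB]; exists (fun i j => f j @^-1` P i j).
  move=> i j; apply: cf; have := nP i j.
  by rewrite FE mxE ord1.
move=> y yP; apply: PB => i j; have := yP i j.
by rewrite FE mxE ord1.
Qed.

Lemma measurable_translation theta : measurable_fun setT (translation theta).
Proof.
apply: (@measurable_coordinatewise (fun i t => t + theta 0 i)).
  by move=> i t; apply: cvgD; [exact: cvg_id | exact: cvg_cst].
by move=> x; apply/rowP => i; rewrite !mxE.
Qed.

Lemma measurable_dilation theta : measurable_fun setT (dilation theta).
Proof.
apply: (@measurable_coordinatewise (fun i t => theta 0 i * t)) => //.
by move=> i t; apply: cvgM; [exact: cvg_cst | exact: cvg_id].
Qed.

HB.instance Definition _ theta :=
  isMeasurableFun.Build _ _ _ _ (translation theta)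
    (measurable_translation theta).

HB.instance Definition _ theta :=
  isMeasurableFun.Build _ _ _ _ (dilation theta) (measurable_dilation theta).

Definition translate (mu : probability (Rvec R m) R) (theta : 'rV[R]_m) :
    probability (Rvec R m) R :=
  distribution mu (translation theta).

Definition dilate (mu : probability (Rvec R m) R) (theta : 'rV[R]_m) :
    probability (Rvec R m) R :=
  distribution mu (dilation theta).

End pushforward_maps.

Definition positive_orthant (R : realType) (m : nat) : set 'rV[R]_m :=
  [set theta | forall i, 0 < theta 0 i].
Arguments positive_orthant : clear implicits.

(* The second moment M_2(P_i mu) of the i-th one-dimensional marginal. *)
Definition marginal_second_moment (R : realType) (m : nat)
    (mu : probability (Rvec R m) R) (i : 'I_m) : R :=
  fine (\int[mu]_x (`|(x : 'rV[R]_m) 0 i| ^+ 2)%:E)%E.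

Definition dilation_scaling (R : realType) (m : nat)
    (mu : probability (Rvec R m) R) : 'M[R]_m :=
  diag_mx (\row_(i < m) Num.sqrt (marginal_second_moment mu i)).

Section wassmap.
Context (R : realType) (m N d : nat).
Implicit Type mu : 'I_N -> probability (Rvec R m) R.

Definition wassmap_W mu : 'M[R]_N :=
  \matrix_(i, j) fine (W2 (mu i) (mu j)) ^+ 2.

Definition wassmap_B mu : 'M[R]_N :=
  let H := 1%:M - N%:R^-1 *: const_mx 1 in
  - 2^-1 *: (H *m wassmap_W mu *m H).

(* [U] is an orthonormal eigenbasis of [B] with eigenvalues [l] in
   nonincreasing order; [V] and [L] keep the first [d] of them, and the
   columns of index at least N (when d > N) are zero. *)
Definition truncated_eigendecomposition (B : 'M[R]_N)
    (V : 'M[R]_(N, d)) (L : 'rV[R]_d) : Prop :=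
  exists (U : 'M[R]_N) (l : 'rV[R]_N),
    [/\ U^T *m U = 1%:M,
        B *m U = U *m diag_mx l,
        forall j k : 'I_N, (j <= k)%N -> l 0 k <= l 0 j,
        V = \matrix_(i, k) oapp (fun k' : 'I_N => U i k') 0 (insub (val k))
      & L = \row_k oapp (fun k' : 'I_N => l 0 k') 0 (insub (val k))].

Definition wassmap_output (V : 'M[R]_(N, d)) (L : 'rV[R]_d) : 'M[R]_(N, d) :=
  V *m diag_mx (map_mx Num.sqrt L).

(* The existence clause says that the truncated eigendecomposition can be
   taken, so that the universal clause is not vacuous. The isometry x |-> Q x + b acts on
   row vectors as x |-> x Q^T + b. *)
Definition wassmap_recovers mu (y : 'I_N -> 'rV[R]_d) : Prop :=
  (exists V L, truncated_eigendecomposition (wassmap_B mu) V L) /\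
  forall V L, truncated_eigendecomposition (wassmap_B mu) V L ->
    (forall k, 0 <= L 0 k) /\
    exists (Q : 'M[R]_d) (b : 'rV[R]_d), Q^T *m Q = 1%:M /\
      forall i, row i (wassmap_output V L) = y i *m Q^T + b.

End wassmap.

(* Main.v *)
From HB Require Import structures.
Require Import Defs.
From mathcomp Require Import all_boot all_order all_algebra.
From mathcomp Require Import all_classical all_reals all_analysis.
From mathcomp Require Import measurable_realfun perm spectral complex ring lra.

Set Implicit Arguments.
Unset Strict Implicit.
Unset Printing Implicit Defensive.

Import Order.TTheory GRing.Theory Num.Theory.
Import numFieldNormedType.Exports.

Local Open Scope classical_set_scope.
Local Open Scope ring_scope.

(* The parametrizations are isometric up to the scaling S: W_2(mu_s, mu_t) is
   |s - t| for translations and |S s - S t| for dilations. The obvious coupling,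
   the joint image of mu_0 under the two maps, gives the upper bound, and an
   explicit pair of quadratic Kantorovich potentials the lower bound. Hence B is
   the Gram matrix of the centered parameters, the nonnegative spectrum of B has
   at most m nonzero elements, so that V_d Lambda_d V_d^T = B, and two
   configurations with the same Gram matrix differ by an orthogonal map. *)

(** * Orthogonal matrices: reflections, Gram matrices, the spectral theorem *)

Lemma mulmx_tr_rV (R : comPzRingType) n (u v : 'rV[R]_n) :
  u *m v^T = v *m u^T.
Proof.
apply/matrixP => i j; rewrite !ord1 !mxE.
by apply: eq_bigr => k _; rewrite !mxE mulrC.
Qed.

Section real_orthogonal.
Variable R : rcfType.

Lemma rV_sqr_ge0 n (u : 'rV[R]_n) : 0 <= (u *m u^T) 0 0.
Proof. by rewrite mxE sumr_ge0// => i _; rewrite mxE -expr2 sqr_ge0. Qed.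

Lemma rV_sqr_eq0 n (u : 'rV[R]_n) : ((u *m u^T) 0 0 == 0) = (u == 0).
Proof.
apply/eqP/eqP => [|->]; last by rewrite mul0mx mxE.
rewrite mxE => /eqP; rewrite psumr_eq0 => [/allP u0|i _]; last first.
  by rewrite mxE -expr2 sqr_ge0.
apply/rowP => i; have := u0 i (mem_index_enum _).
by rewrite !mxE -expr2 sqrf_eq0 => /eqP.
Qed.

(** The third clause is what inductive alignment needs: rows already placed have equal inner
    products with [u] and [v], so they are orthogonal to [u - v] and the reflection leaves them
    alone. *)
Lemma reflection_exchange n (u v : 'rV[R]_n) : u *m u^T = v *m v^T ->
  exists P : 'M[R]_n, [/\ P^T *m P = 1%:M, u *m P = v &
    forall w : 'rV[R]_n, w *m u^T = w *m v^T -> w *m P = w].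
Proof.
move=> uv; have [<-|neq_uv] := eqVneq u v.
  by exists 1%:M; split => [||w _]; rewrite ?trmx1 mulmx1.
(* Householder reflection along u - v *)
have [x xE] : {x : 'rV[R]_n | x = u - v} by exists (u - v).
have [s sE] : {s | s = (x *m x^T) 0 0} by exists ((x *m x^T) 0 0).
have s0 : s != 0 by rewrite sE rV_sqr_eq0 xE subr_eq0.
have xx : x *m x^T = s%:M by rewrite sE [LHS]mx11_scalar.
exists (1%:M - (2 / s) *: (x^T *m x)); split.
- have -> : (1%:M - (2 / s) *: (x^T *m x))^T = 1%:M - (2 / s) *: (x^T *m x).
    by rewrite linearB/= trmx1 linearZ/= trmx_mul trmxK.
  rewrite mulmxBl mul1mx mulmxBr mulmx1.
  rewrite -scalemxAl -scalemxAr mulmxA -[_ *m x *m _]mulmxA xx.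
  rewrite mul_mx_scalar -scalemxAl !scalerA opprB.
  have -> : 2 / s * (2 / s * s) = 2 / s + 2 / s by field.
  by rewrite scalerDl addrK subrK.
(* Since [u] and [v] have equal norms, the squared norm [s] of [u - v] is twice the inner product of
   [u] with [u - v]; the reflection therefore subtracts exactly [x] from [u]. *)
- have ux : u *m x^T = (s / 2)%:M.
    rewrite [LHS]mx11_scalar sE {2}xE mulmxBl xE linearB/= !mulmxBr -uv.
    by rewrite (mulmx_tr_rV v u) !mxE; congr _%:M; field.
  rewrite mulmxBr mulmx1 -scalemxAr mulmxA ux mul_scalar_mx scalerA.
  by rewrite (_ : 2 / s * (s / 2) = 1) ?scale1r ?xE ?subKr//; field.
- move=> w wuv; have wx : w *m x^T = 0.
    by rewrite xE linearB/= mulmxBr wuv subrr.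
  by rewrite mulmxBr mulmx1 -scalemxAr mulmxA wx mul0mx scaler0 subr0.
Qed.

Lemma orthogonal_mul n (P Q : 'M[R]_n) : P^T *m P = 1%:M -> Q^T *m Q = 1%:M ->
  (P *m Q)^T *m (P *m Q) = 1%:M.
Proof. by move=> P1 Q1; rewrite trmx_mul mulmxA -(mulmxA Q^T) P1 mulmx1. Qed.

(* Align the rows one at a time: the reflection moving the k-th row of A P to
   the k-th row of B fixes the previous rows, as the Gram matrices agree. *)
Lemma gram_eq_orthogonal N d (A B : 'M[R]_(N, d)) : A *m A^T = B *m B^T ->
  exists Q : 'M[R]_d, Q^T *m Q = 1%:M /\ A *m Q = B.
Proof.
move=> AB.
suff /(_ N)[Q [Q1 AQ]] : forall k, exists Q : 'M[R]_d, Q^T *m Q = 1%:M /\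
    forall i : 'I_N, (i < k)%N -> row i (A *m Q) = row i B.
  by exists Q; split => //; apply/row_matrixP => i; exact: AQ.
elim=> [|k [Q [Q1 AQ]]]; first by exists 1%:M; rewrite trmx1 mulmx1; split.
have [Nk|kN] := leqP N k.
  by exists Q; split => // i _; rewrite AQ// (leq_trans (ltn_ord i)).
pose K := Ordinal kN.
have gramE i j : row i (A *m Q) *m (row j (A *m Q))^T = row i B *m (row j B)^T.
  have QQ : Q *m Q^T = 1%:M by exact: mulmx1C.
  have E (M : 'M[R]_(N, d)) : row i M *m (row j M)^T = ((M *m M^T) i j)%:M.
    rewrite [LHS]mx11_scalar !mxE; congr _%:M.
    by apply: eq_bigr => l _; rewrite !mxE.
  by rewrite !E trmx_mul mulmxA -(mulmxA A) QQ mulmx1 AB.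
have [P [P1 PK Pfix]] := reflection_exchange (gramE K K).
exists (Q *m P); split; first exact: orthogonal_mul.
move=> i; rewrite ltnS leq_eqVlt mulmxA row_mul => /predU1P[ik|ik].
  by rewrite (_ : i = K)//; exact: val_inj.
by rewrite Pfix ?gramE AQ.
Qed.

(** An eigenvalue exists over the algebraically closed field [R[i]]. Symmetry forces its imaginary
    part to vanish, and then the real and imaginary parts of the eigenvector are each fixed up to
    the real scalar [x]; one of them is nonzero. *)
Lemma symmetric_eigenvector n (A : 'M[R]_n.+1) : A^T = A ->
  exists (l : R) (u : 'rV[R]_n.+1), u *m u^T = 1%:M /\ u *m A = l *: u.
Proof.
move=> sA.
have [[x y] /eigenvalueP[w wA w0]] :=
  eigenvalue_closed (map_mx (real_complex R) A) (ltn0Sn n).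
pose a : 'rV[R]_n.+1 := map_mx (@complex.Re R) w.
pose b : 'rV[R]_n.+1 := map_mx (@complex.Im R) w.
have aA : a *m A = x *: a - y *: b.
  apply/rowP => j; have /rowP/(_ j)/(congr1 (@complex.Re R)) := wA.
  rewrite !mxE (big_morph (@complex.Re R) (id1 := 0) (op1 := +%R)) //;
    last by case=> ? ? [].
  move=> E; transitivity (complex.Re ((x +i* y)%C * w 0 j)); last by case: (w 0 j).
  rewrite -E; apply: eq_bigr => k _; rewrite !mxE.
  by case: (w 0 k) => c d /=; ring.
have bA : b *m A = y *: a + x *: b.
  apply/rowP => j; have /rowP/(_ j)/(congr1 (@complex.Im R)) := wA.
  rewrite !mxE (big_morph (@complex.Im R) (id1 := 0) (op1 := +%R)) //;
    last by case=> ? ? [].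
  move=> E; transitivity (complex.Im ((x +i* y)%C * w 0 j)); last first.
    by case: (w 0 j) => c d /=; ring.
  rewrite -E; apply: eq_bigr => k _; rewrite !mxE.
  by case: (w 0 k) => c d /=; ring.
have ab0 : (a != 0) || (b != 0).
  rewrite -negb_and; apply: contra w0 => /andP[/eqP a0 /eqP b0].
  apply/eqP/rowP => j; have /rowP/(_ j) := a0; have /rowP/(_ j) := b0.
  by rewrite !mxE; case: (w 0 j) => c d /= -> ->.
(* Computing the symmetric form of [a] and [b] in both orders gives y (|a|^2 + |b|^2) = 0. *)
have y0 : y = 0.
  have : a *m A *m b^T = b *m A *m a^T.
    by rewrite mulmx_tr_rV trmx_mul sA mulmxA.
  rewrite aA bA mulmxBl mulmxDl -!scalemxAl (mulmx_tr_rV b a).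
  move=> /matrixP/(_ 0 0); rewrite ![in LHS]mxE ![in RHS]mxE => E.
  have : y * ((a *m a^T) 0 0 + (b *m b^T) 0 0) = 0.
    by move: E; rewrite !mxE; lra.
  move=> /eqP; rewrite mulf_eq0 => /orP[/eqP//|].
  rewrite paddr_eq0 ?rV_sqr_ge0// !rV_sqr_eq0.
  by move: ab0; rewrite -negb_and => /negPf ->.
have [u u0 uA] : exists2 u : 'rV[R]_n.+1, u != 0 & u *m A = x *: u.
  case/orP: ab0 => [a0|b0]; [exists a => //|exists b => //].
    by rewrite aA y0 scale0r subr0.
  by rewrite bA y0 scale0r add0r.
have u2 : 0 < (u *m u^T) 0 0 by rewrite lt_def rV_sqr_eq0 u0 rV_sqr_ge0.
exists x, ((Num.sqrt ((u *m u^T) 0 0))^-1 *: u); split.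
  rewrite linearZ/= -scalemxAl -scalemxAr scalerA -expr2 exprVn sqr_sqrtr ?ltW//.
  by rewrite [X in _ *: X]mx11_scalar scale_scalar_mx mulVf// gt_eqF.
by rewrite -scalemxAl uA !scalerA mulrC.
Qed.

(** Deflation: an orthogonal change of basis carries the first basis vector to a unit eigenvector,
    and induction applies to the remaining diagonal block. *)
Lemma symmetric_diagonalization n (A : 'M[R]_n) : A^T = A ->
  exists (U : 'M[R]_n) (l : 'rV[R]_n),
    U^T *m U = 1%:M /\ A *m U = U *m diag_mx l.
Proof.
elim: n A => [|n IH] A sA.
  by exists 1%:M, 0; split; apply/matrixP => -[].
have [l [u [u1 uA]]] := symmetric_eigenvector sA.
pose e : 'rV[R]_(1 + n) := row_mx 1%:M 0.
have /reflection_exchange[P [P1 eP _]] : e *m e^T = u *m u^T.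
  by rewrite u1 /e tr_row_mx mul_row_col trmx1 mulmx1 mul0mx addr0.
have PP : P *m P^T = 1%:M by exact: mulmx1C.
pose C : 'M[R]_(1 + n) := P *m A *m P^T.
have sC : C^T = C by rewrite /C !trmx_mul trmxK sA mulmxA.
have eC : e *m C = l *: e.
  by rewrite /C !mulmxA eP uA -scalemxAl -eP -mulmxA PP mulmx1.
(* The first row of [C] is [e *m C], hence a multiple of [e]; symmetry then clears the first column
   as well. *)
have ulC : usubmx C = row_mx l%:M 0.
  transitivity (e *m C); last by rewrite eC /e scale_row_mx scaler0 scalemx1.
  by rewrite -{2}[C]vsubmxK /e mul_row_col mul1mx mul0mx addr0.
have CE : C = block_mx l%:M 0 0 (drsubmx C).
  rewrite -{1}[C]submxK -/(ulsubmx C).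
  have -> : ulsubmx C = l%:M by rewrite /ulsubmx ulC row_mxKl.
  have urC : ursubmx C = 0 by rewrite /ursubmx ulC row_mxKr.
  have dlC : dlsubmx C = 0 by rewrite -[LHS]trmxK trmx_dlsub sC urC trmx0.
  by rewrite urC dlC.
have [|V [k [V1 CV]]] := IH (drsubmx C); first by rewrite trmx_drsub sC.
pose W : 'M[R]_(1 + n) := block_mx 1%:M 0 0 V.
pose r : 'rV[R]_(1 + n) := row_mx l%:M k.
have W1 : W^T *m W = 1%:M.
  rewrite /W tr_block_mx !trmx0 trmx1 mulmx_block !mulmx0 !mul0mx !addr0 !add0r.
  by rewrite mulmx1 V1 -scalar_mx_block.
have CW : C *m W = W *m diag_mx r.
  rewrite CE /W /r diag_mx_row !mulmx_block !mulmx0 !mul0mx !addr0 !add0r.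
  rewrite mulmx1 mul1mx CV; congr block_mx.
  by apply/matrixP => i j; rewrite !ord1 !mxE eqxx !mulr1n.
exists (P^T *m W), r; split; first by apply: orthogonal_mul; rewrite ?trmxK.
by rewrite -mulmxA -[W *m _]CW /C !mulmxA P1 mul1mx.
Qed.

Lemma sorted_diagonalization n (A : 'M[R]_n) : A^T = A ->
  exists (U : 'M[R]_n) (l : 'rV[R]_n),
    [/\ U^T *m U = 1%:M, A *m U = U *m diag_mx l &
        forall j k : 'I_n, (j <= k)%N -> l 0 k <= l 0 j].
Proof.
move=> /symmetric_diagonalization[U [l [U1 AU]]].
pose s := sort (fun j k => l 0 k <= l 0 j) (enum 'I_n).
have sz : size s = n by rewrite size_sort size_enum_ord.
(* The sorted enumeration has no repetition, so reading it by position is a permutation. The default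
   [i] of [nth] is never reached, as [s] has size [n]. *)
have inj : injective (fun i : 'I_n => nth i s i).
  move=> i j; rewrite (set_nth_default i j) ?sz// => /eqP.
  by rewrite nth_uniq ?sz// ?sort_uniq ?enum_uniq// => /eqP; exact: val_inj.
exists (col_perm (perm inj) U), (col_perm (perm inj) l); split.
- rewrite tr_col_perm; apply/matrixP => i j.
  have /matrixP/(_ (perm inj i) (perm inj j)) := U1.
  by rewrite !mxE (inj_eq perm_inj) => <-; apply: eq_bigr => k _; rewrite !mxE.
- apply/matrixP => i j; have /matrixP/(_ i (perm inj j)) := AU.
  by rewrite !mul_mx_diag !mxE => <-; apply: eq_bigr => k _; rewrite !mxE.
- move=> j k jk; rewrite !mxE !permE (set_nth_default j k) ?sz//.
  have tr : transitive (fun j k : 'I_n => l 0 k <= l 0 j).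
    by move=> a b c /[swap]; exact: le_trans.
  apply: (sorted_leq_nth tr) => //; rewrite ?inE ?sz//.
  by apply: sort_sorted => a b; exact: le_total.
Qed.

End real_orthogonal.

(** * Classical multidimensional scaling *)

Section multidimensional_scaling.
Variable R : realType.

(** This treats truncation and padding together: if d <= N the dropped terms vanish by hypothesis,
    and if N < d the extra terms are the default 0 of [oapp]. *)
Lemma sum_insub N d (F : 'I_N -> R) :
  (forall k : 'I_N, (d <= k)%N -> F k = 0) ->
  \sum_(k < d) oapp F 0 (insub (val k)) = \sum_(k < N) F k.
Proof.
move=> F0; pose G n := oapp F 0 (insub n).
have G0 n : (d <= n)%N -> G n = 0.
  by rewrite /G; case: insubP => //= k _ <- /F0.
have GN n : (N <= n)%N -> G n = 0 by move=> Nn; rewrite /G insubN// -leqNgt.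
transitivity (\sum_(k < N) G k); last by apply: eq_bigr => k _; rewrite /G valK.
rewrite -[LHS](big_mkord xpredT G) -[RHS](big_mkord xpredT G).
have [dN|/ltnW Nd] := leqP d N.
  rewrite [RHS](big_cat_nat (n := d))//= [X in _ = _ + X]big_nat_cond.
  by rewrite [X in _ = _ + X]big1 ?addr0// => n /andP[/andP[/G0]].
rewrite [LHS](big_cat_nat (n := N))//= [X in _ + X = _]big_nat_cond.
by rewrite [X in _ + X]big1 ?addr0// => n /andP[/andP[/GN]].
Qed.

(* A nonzero k-th eigenvalue with k >= d would give k + 1 linearly independent
   rows of length d. *)
Lemma gram_diag_eq0 N d (X : 'M[R]_(N, d)) (l : 'rV[R]_N) :
  X *m X^T = diag_mx l -> (forall j k : 'I_N, (j <= k)%N -> l 0 k <= l 0 j) ->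
  forall k : 'I_N, 0 <= l 0 k /\ ((d <= k)%N -> l 0 k = 0).
Proof.
move=> XX l_sorted k.
have l_ge0 j : 0 <= l 0 j.
  have /matrixP/(_ j j) := XX; rewrite !mxE eqxx mulr1n => <-.
  by apply: sumr_ge0 => i _; rewrite mxE -expr2 sqr_ge0.
split => // dk; apply/eqP/negPn/negP => lk0.
pose f : 'I_k.+1 -> 'I_N := widen_ord (ltn_ord k).
pose Y := rowsub f X.
have YY : Y *m Y^T = diag_mx (colsub f l).
  apply/matrixP => i j; have /matrixP/(_ (f i) (f j)) := XX; rewrite !mxE.
  rewrite -[f i == f j]/(i == j) => <-.
  by apply: eq_bigr => s _; rewrite !mxE.
(* By monotonicity the first k + 1 eigenvalues are at least [l 0 k], which is positive, so this
   diagonal matrix has nonzero determinant. *)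
have /mxrank_unit rk : Y *m Y^T \in unitmx.
  rewrite YY unitmxE det_diag unitfE; apply/prodf_neq0 => i _; rewrite mxE.
  rewrite gt_eqF// (lt_le_trans _ (l_sorted _ k _))//; last exact: (leq_ord i).
  by rewrite lt_def lk0 l_ge0.
have := mxrankM_maxl Y Y^T; rewrite rk => /leq_trans/(_ (rank_leq_col Y)).
by rewrite ltnNge dk.
Qed.

(** The rows of [U^T *m X] have Gram matrix [diag_mx l], so the eigenvalues are nonnegative and
    vanish from index d on: truncation loses nothing. The Gram matrix of the output is thus
    independent of the chosen eigenvectors. *)
Lemma truncated_eigendecomposition_gram N d (X V : 'M[R]_(N, d)) (L : 'rV[R]_d) :
  truncated_eigendecomposition (X *m X^T) V L ->
  (forall k, 0 <= L 0 k) /\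
  wassmap_output V L *m (wassmap_output V L)^T = X *m X^T.
Proof.
move=> [U [l [U1 BU l_sorted VE LE]]].
have UU : U *m U^T = 1%:M by exact: mulmx1C.
have XX : (U^T *m X) *m (U^T *m X)^T = diag_mx l.
  by rewrite trmx_mul trmxK mulmxA -(mulmxA _ X) -mulmxA BU mulmxA U1 mul1mx.
have l0 := gram_diag_eq0 XX l_sorted.
have L0 k : 0 <= L 0 k.
  by rewrite LE mxE; case: insubP => //= j _ _; have [] := l0 j.
split => //.
have -> : X *m X^T = U *m diag_mx l *m U^T by rewrite -BU -mulmxA UU mulmx1.
rewrite /wassmap_output mul_mx_diag mul_mx_diag.
apply/matrixP => i j; rewrite !mxE.
rewrite -(@sum_insub N d); last first.
  by move=> k dk; rewrite !mxE (l0 k).2// mulr0 mul0r.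
apply: eq_bigr => k _.
rewrite !mxE mulrACA -expr2 sqr_sqrtr// VE LE !mxE.
by case: insubP => [s _ _|_] /=; rewrite ?mxE ?mul0r// mulrAC.
Qed.

(** Both families of measures are instances: only the squared distances enter, and the ambient
    dimension [m] is unrelated to the embedding dimension [d]. *)
Lemma wassmap_recovers_isometric m N d (mu : 'I_N -> probability (Rvec R m) R)
    (y : 'I_N -> 'rV[R]_d) :
  (forall i j, fine (W2 (mu i) (mu j)) ^+ 2 =
               ((y i - y j) *m (y i - y j)^T) 0 0) ->
  wassmap_recovers mu y.
Proof.
move=> W2E.
pose J : 'M[R]_N := const_mx 1; pose H : 'M[R]_N := 1%:M - N%:R^-1 *: J.
pose Y := \matrix_i y i.
have JJ : J *m J = N%:R *: J.
  apply/matrixP => i j; rewrite !mxE (eq_bigr (fun=> 1)) => [|k _].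
    by rewrite sumr_const card_ord mulr1.
  by rewrite !mxE mulr1.
(* An entry of [J] provides an index below N, so N is nonzero; for N = 0 the matrices are empty. *)
have NJ : N%:R^-1 * N%:R *: J = J.
  apply/matrixP => i j; rewrite !mxE mulVf ?mulr1// pnatr_eq0 -lt0n.
  exact: leq_ltn_trans (ltn_ord i).
have HJ : H *m J = 0 by rewrite mulmxBl mul1mx -scalemxAl JJ scalerA NJ subrr.
have JH : J *m H = 0 by rewrite mulmxBr mulmx1 -scalemxAr JJ scalerA NJ subrr.
have HT : H^T = H by rewrite linearB/= linearZ/= trmx1 trmx_const.
have BE : wassmap_B mu = (H *m Y) *m (H *m Y)^T.
  pose D := diag_mx (\row_i (y i *m (y i)^T) 0 0).
  rewrite /wassmap_B -/J -/H.
  (* Expand |y_i - y_j|^2. Centering kills the two squared-norm terms, since H J = J H = 0, and the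
     factor -1/2 turns the cross term into the Gram matrix of [H *m Y]. *)
  have -> : wassmap_W mu = D *m J + J *m D - 2 *: (Y *m Y^T).
    apply/matrixP => i j; rewrite mul_diag_mx mul_mx_diag !mxE W2E.
    rewrite mulr1 mul1r mxE mulr_sumr -big_split/= -sumrB.
    by apply: eq_bigr => k _; rewrite !mxE; ring.
  move: HJ JH HT; move: (H) => K HJ JH HT.
  rewrite mulmxBr mulmxDr mulmxBl mulmxDl !mulmxA HJ !mul0mx addr0.
  rewrite -(mulmxA _ J) JH mulmx0 sub0r -scalemxAr -scalemxAl.
  by rewrite -scaleNr scalerA mulrNN mulVf// scale1r trmx_mul HT !mulmxA.
rewrite /wassmap_recovers BE; split.
  have [|U [l [U1 AU ls]]] := @sorted_diagonalization R N (H *m Y *m (H *m Y)^T).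
    by rewrite trmx_mul trmxK.
  by do 2!eexists; exists U, l; split; first [exact: erefl | assumption].
move=> V L /truncated_eigendecomposition_gram[L0].
move=> /esym/gram_eq_orthogonal[Q [Q1 <-]]; split=> //.
(* The shift undoes the centering: it is minus the mean of the [y i], moved by [Q]. *)
exists Q^T, (- (N%:R^-1 *: (const_mx 1 *m Y *m Q))).
rewrite trmxK; split=> [|i]; first exact: mulmx1C.
have -> : H *m Y *m Q = Y *m Q - N%:R^-1 *: (J *m Y *m Q).
  by rewrite /H !mulmxBl mul1mx -!scalemxAl.
by rewrite linearB/= linearZ/= !row_mul rowK row_const.
Qed.

End multidimensional_scaling.

(** * Change of variables between maps with equal laws *)

Section equal_laws.
Context d1 d2 d (X1 : measurableType d1) (X2 : measurableType d2)
  (Y : measurableType d) (R : realType).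
Variables (P1 : probability X1 R) (P2 : probability X2 R).
Variables (f1 : {mfun X1 >-> Y}) (f2 : {mfun X2 >-> Y}).
Hypothesis eq_law : forall A, measurable A -> P1 (f1 @^-1` A) = P2 (f2 @^-1` A).

Let eq_law_integral_law (h : Y -> \bar R) :
  (\int[distribution P1 f1]_y h y = \int[distribution P2 f2]_y h y)%E.
Proof. by apply: eq_measure_integral => A mA _; exact: eq_law. Qed.

Lemma eq_law_ge0_integral (h : Y -> \bar R) : measurable_fun setT h ->
  (forall y, 0 <= h y)%E ->
  (\int[P1]_x h (f1 x) = \int[P2]_x h (f2 x))%E.
Proof.
move=> mh h0.
have := eq_law_integral_law h.
by rewrite [LHS]ge0_integral_pushforward// [RHS]ge0_integral_pushforward.
Qed.

Lemma eq_law_integrable (h : Y -> \bar R) : measurable_fun setT h ->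
  P1.-integrable setT (h \o f1) -> P2.-integrable setT (h \o f2).
Proof.
move=> mh /integrableP[_ hf1]; apply/integrableP; split.
  exact: measurableT_comp.
rewrite -(@eq_law_ge0_integral (fun y => `|h y|%E))//.
exact: measurableT_comp.
Qed.

(** Both integrals equal the one against the common image measure. This carries a potential from the
    base measure, composed with a transport map, to an arbitrary coupling, composed with a
    projection. *)
Lemma eq_law_integral (h : Y -> \bar R) : measurable_fun setT h ->
  P1.-integrable setT (h \o f1) ->
  (\int[P1]_x h (f1 x) = \int[P2]_x h (f2 x))%E.
Proof.
move=> mh hf1; have hf2 := eq_law_integrable mh hf1.
have := eq_law_integral_law h.
by rewrite [LHS]integral_pushforward// [RHS]integral_pushforward.
Qed.

End equal_laws.

(** * The quadratic cost and optimality of a coupling *)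

Section euclidean_cost.
Context (R : realType) (m : nat).

Lemma euclid_norm_sqr (x : 'rV[R]_m) :
  euclid_norm x ^+ 2 = \sum_i x 0 i ^+ 2.
Proof.
rewrite /euclid_norm sqr_sqrtr; last by apply: sumr_ge0 => i _; exact: exprn_ge0.
by apply: eq_bigr => i _; rewrite real_normK ?num_real.
Qed.

Lemma measurable_coordinate (i : 'I_m) :
  measurable_fun setT (fun x : Rvec R m => (x : 'rV[R]_m) 0 i).
Proof.
apply: (measurability _ (RGenOpens.measurableE R)) => _ [_ [a [b ->]] <-].
rewrite setTI; apply: sub_sigma_algebra.
have /continuousP := @coord_continuous R 1 m 0 i.
by apply; exact: itv_open.
Qed.

Definition cost (z : Rvec R m * Rvec R m) : \bar R :=
  (euclid_norm ((z.1 : 'rV[R]_m) - z.2) ^+ 2)%:E.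

Lemma cost_ge0 z : (0 <= cost z)%E.
Proof. by rewrite lee_fin exprn_ge0// sqrtr_ge0. Qed.

Lemma measurable_cost : measurable_fun setT cost.
Proof.
rewrite (_ : cost = fun z =>
  (\sum_i ((z.1 : 'rV[R]_m) 0 i - (z.2 : 'rV[R]_m) 0 i) ^+ 2)%:E); last first.
  apply/funext => z; rewrite /cost euclid_norm_sqr.
  by congr EFin; apply: eq_bigr => i _; rewrite !mxE.
apply/measurable_EFinP; apply: measurable_sum => i.
apply: measurable_funX; apply: measurable_funB.
  exact: (measurableT_comp (measurable_coordinate i) measurable_fst).
exact: (measurableT_comp (measurable_coordinate i) measurable_snd).
Qed.

(* Kantorovich duality for a coupling induced by a pair of maps: the potentials
   phi and psi certify its optimality. *)
Lemma W2_pushforward (mu : probability (Rvec R m) R)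
    (S T : {mfun Rvec R m >-> Rvec R m}) (phi psi : Rvec R m -> R) :
  measurable_fun setT phi -> measurable_fun setT psi ->
  mu.-integrable setT (EFin \o (phi \o S)) ->
  mu.-integrable setT (EFin \o (psi \o T)) ->
  (forall x y : Rvec R m,
    phi x + psi y <= euclid_norm ((x : 'rV[R]_m) - y) ^+ 2) ->
  (forall w, phi (S w) + psi (T w) = euclid_norm ((S w : 'rV[R]_m) - T w) ^+ 2) ->
  fine (W2 (distribution mu S) (distribution mu T)) ^+ 2 =
  fine (\int[mu]_w (euclid_norm ((S w : 'rV[R]_m) - T w) ^+ 2)%:E).
Proof.
move=> mphi mpsi iphi ipsi phi_psi phi_psi_eq.
have mphiE : measurable_fun setT (EFin \o phi) by exact/measurable_EFinP.
have mpsiE : measurable_fun setT (EFin \o psi) by exact/measurable_EFinP.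
have IE : (\int[mu]_w cost (S w, T w) =
    \int[mu]_w (phi (S w))%:E + \int[mu]_w (psi (T w))%:E)%E.
  rewrite -integralD//; apply: eq_integral => w _.
  by rewrite /cost/= -phi_psi_eq.
set I := (\int[mu]_w _)%E in IE *.
have I0 : (0 <= I)%E by apply: integral_ge0 => w _; exact: cost_ge0.
have Ifin : I \is a fin_num.
  by rewrite IE fin_numD !integrable_fin_num.
have lower gamma : couplings (distribution mu S) (distribution mu T) gamma ->
    (I <= \int[gamma]_z cost z)%E.
  move=> gammaP.
  pose fst' : {mfun (Rvec R m * Rvec R m)%type >-> Rvec R m} :=
    HB.pack fst (isMeasurableFun.Build _ _ _ _ _ measurable_fst).
  pose snd' : {mfun (Rvec R m * Rvec R m)%type >-> Rvec R m} :=
    HB.pack snd (isMeasurableFun.Build _ _ _ _ _ measurable_snd).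
  have law1 A : measurable A -> mu (S @^-1` A) = gamma (fst' @^-1` A).
    by move=> mA; rewrite -setXT; exact/esym/(gammaP A mA).1.
  have law2 A : measurable A -> mu (T @^-1` A) = gamma (snd' @^-1` A).
    by move=> mA; rewrite -setTX; exact/esym/(gammaP A mA).2.
  have iphi1 := eq_law_integrable law1 mphiE iphi.
  have ipsi2 := eq_law_integrable law2 mpsiE ipsi.
  (* A coupling of infinite cost needs no argument; finite cost makes [cost] integrable, so that it
     can be compared with the sum of the potentials. *)
  have [->|foo] := eqVneq (\int[gamma]_z cost z)%E +oo%E; first exact: leey.
  have icost : gamma.-integrable setT cost.
    apply/integrableP; split; first exact: measurable_cost.
    rewrite (eq_integral cost) ?ltey// => z _.
    by rewrite gee0_abs// cost_ge0.
  rewrite IE (eq_law_integral law1 mphiE iphi) (eq_law_integral law2 mpsiE ipsi).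
  rewrite -integralD//; apply: le_integral => //; first exact: integrableD.
  by move=> z _; rewrite /cost lee_fin.
(* The upper bound comes from the joint image of [mu] under [S] and [T], whose cost is [I]. *)
have mST : measurable_fun setT (fun w => (S w, T w)).
  by apply: measurable_fun_pair.
pose ST : {mfun Rvec R m >-> (Rvec R m * Rvec R m)%type} :=
  HB.pack (fun w => (S w, T w)) (isMeasurableFun.Build _ _ _ _ _ mST).
have STP : couplings (distribution mu S) (distribution mu T) (distribution mu ST).
  move=> A mA; split; rewrite /distribution/= /pushforward; congr (mu _).
    by apply/seteqP; split => w //= -[].
  by apply/seteqP; split => w //= -[].
have STI : (\int[distribution mu ST]_z cost z = I)%E.
  rewrite ge0_integral_pushforward//; first exact: measurable_cost.
  by move=> z _; exact: cost_ge0.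
(* The lower bound passes through the square root by monotonicity of [poweR]; finiteness of [I] lets
   [fine] and the final squaring return it unchanged. *)
have -> : W2 (distribution mu S) (distribution mu T) = poweR I 2^-1.
  apply/eqP; rewrite eq_le; apply/andP; split.
    by apply: ereal_inf_lbound; exists (distribution mu ST) => //; rewrite STI.
  apply: le_ereal_inf_tmp => _ [gamma /lower Igamma <-].
  apply: gt0_ler_poweR => //; rewrite ?invr_ge0// in_itv/= ?leey ?andbT//.
  exact: le_trans Igamma.
rewrite -(fineK Ifin)/= powR12_sqrt ?fine_ge0// sqr_sqrtr//.
exact: fine_ge0.
Qed.

End euclidean_cost.

(** * Quadratic potentials and the distances in the two families *)

Section separable_quadratics.
Context (R : realType) (m : nat).
Implicit Types (a b c : 'I_m -> R) (mu : probability (Rvec R m) R).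

(** A class containing all the potentials and stable under coordinatewise affine maps, so one
    measurability proof and one integrability proof serve both families. *)
Definition quad a b c (x : Rvec R m) : R :=
  \sum_i (a i * (x : 'rV[R]_m) 0 i ^+ 2 + b i * (x : 'rV[R]_m) 0 i + c i).

Lemma measurable_quad a b c : measurable_fun setT (quad a b c).
Proof.
apply: measurable_sum => i; have mi := @measurable_coordinate R m i.
apply: measurable_funD => //; apply: measurable_funD.
  by apply: measurable_funM => //; exact: measurable_funX.
exact: measurable_funM.
Qed.

Lemma integrable_coordinate_sqr mu i : finite_second_moment mu ->
  mu.-integrable setT (fun x : Rvec R m => ((x : 'rV[R]_m) 0 i ^+ 2)%:E).
Proof.
move=> mu2; have mi := @measurable_coordinate R m i.
apply: (@le_integrable _ _ _ _ _ measurableT _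
  (fun x : Rvec R m => (euclid_norm (x : 'rV[R]_m) ^+ 2)%:E)).
- by apply/measurable_EFinP; exact: measurable_funX.
- move=> x _; rewrite !abse_EFin lee_fin !ger0_norm ?sqr_ge0//.
  rewrite euclid_norm_sqr (bigD1 i)//= lerDl.
  by apply: sumr_ge0 => j _; exact: sqr_ge0.
- apply/integrableP; split.
    apply/measurable_EFinP.
    rewrite (_ : (fun x => _) = quad (fun=> 1) (fun=> 0) (fun=> 0)).
      exact: measurable_quad.
    apply/funext => x; rewrite euclid_norm_sqr; apply: eq_bigr => j _.
    by rewrite mul1r mul0r !addr0.
  move: mu2; rewrite /finite_second_moment.
  by under [in X in _ -> X]eq_integral do rewrite gee0_abs ?lee_fin ?sqr_ge0//.
Qed.

(** Domination by the integrable function t^2 + 1, the measure being finite. *)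
Lemma integrable_coordinate mu i : finite_second_moment mu ->
  mu.-integrable setT (fun x : Rvec R m => ((x : 'rV[R]_m) 0 i)%:E).
Proof.
move=> mu2; have mi := @measurable_coordinate R m i.
apply: (@le_integrable _ _ _ _ _ measurableT _
  (fun x : Rvec R m => (((x : 'rV[R]_m) 0 i ^+ 2)%:E + 1)%E)).
- exact/measurable_EFinP.
- move=> x _; rewrite -EFinD !abse_EFin lee_fin.
  rewrite [leRHS]ger0_norm ?addr_ge0 ?sqr_ge0// ler_norml.
  by apply/andP; split; nra.
- apply: integrableD => //; first exact: integrable_coordinate_sqr.
  exact: (@finite_measure_integrable_cst _ _ _ mu setT 1).
Qed.

Let integrable_quad_term mu a b c i : finite_second_moment mu ->
  mu.-integrable setT (fun x : Rvec R m =>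
    (a i * (x : 'rV[R]_m) 0 i ^+ 2 + b i * (x : 'rV[R]_m) 0 i + c i)%:E).
Proof.
move=> mu2; under eq_fun do rewrite 2!EFinD (EFinM (a i)) (EFinM (b i)).
apply: integrableD => //; last first.
  exact: (@finite_measure_integrable_cst _ _ _ mu setT (c i)).
apply: integrableD => //; apply: integrableZl => //.
  exact: integrable_coordinate_sqr.
exact: integrable_coordinate.
Qed.

Lemma integrable_quad mu a b c : finite_second_moment mu ->
  mu.-integrable setT (EFin \o quad a b c).
Proof.
move=> mu2; rewrite (_ : _ \o _ = fun x : Rvec R m => (\sum_i
  (a i * (x : 'rV[R]_m) 0 i ^+ 2 + b i * (x : 'rV[R]_m) 0 i + c i)%:E)%E).
  by apply: integrable_sum => // i _; exact: integrable_quad_term.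
by apply/funext => x; rewrite sumEFin.
Qed.

Lemma integral_quad mu a c : finite_second_moment mu ->
  fine (\int[mu]_x (quad a (fun=> 0) c x)%:E) =
  \sum_i (a i * marginal_second_moment mu i + c i).
Proof.
move=> mu2; under eq_integral do rewrite -sumEFin.
rewrite integral_sum//; last by move=> i; exact: integrable_quad_term.
rewrite -sum_fine => [|i _]; last first.
  by apply: integrable_fin_num => //; exact: integrable_quad_term.
apply: eq_bigr => i _.
have isq := integrable_coordinate_sqr i mu2.
under eq_integral do rewrite mul0r addr0 EFinD (EFinM (a i)).
rewrite integralD//; last 2 first.
- exact: integrableZl.
- exact: (@finite_measure_integrable_cst _ _ _ mu setT (c i)).
rewrite integralZl// integral_cst//= probability_setT mule1.
rewrite fineD//; last by rewrite fin_numM// integrable_fin_num.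
rewrite fineM// ?integrable_fin_num//=; congr (_ * _ + _).
rewrite /marginal_second_moment; congr fine; apply: eq_integral => x _.
by rewrite real_normK ?num_real.
Qed.

(** With v = s - t, the potentials come from expanding |x - y - v|^2 >= 0, an equality at x = w + s,
    y = w + t. The cost along this coupling is the constant |v|^2. *)
Lemma W2_translate mu (s t : 'rV[R]_m) : finite_second_moment mu ->
  fine (W2 (translate mu s) (translate mu t)) ^+ 2 =
  ((s - t) *m (s - t)^T) 0 0.
Proof.
move=> mu2; pose v i := s 0 i - t 0 i.
rewrite /translate (@W2_pushforward _ _ mu _ _
  (quad (fun=> 0) (fun i => 2 * v i) (fun i => - v i ^+ 2))
  (quad (fun=> 0) (fun i => - (2 * v i)) (fun=> 0))).
- rewrite (eq_integral
    (fun x => (quad (fun=> 0) (fun=> 0) (fun i => v i ^+ 2) x)%:E)).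
    rewrite integral_quad// mxE; apply: eq_bigr => i _.
    by rewrite mul0r add0r !mxE expr2.
  move=> x _; congr EFin; rewrite euclid_norm_sqr; apply: eq_bigr => i _.
  by rewrite !mxE /v; ring.
- exact: measurable_quad.
- exact: measurable_quad.
(* Composing with the translation only changes the constant terms. *)
- rewrite (_ : _ \o _ = quad (fun=> 0) (fun i => 2 * v i)
    (fun i => 2 * v i * s 0 i - v i ^+ 2)); first exact: integrable_quad.
  by apply/funext => x; apply: eq_bigr => i _; rewrite !mxE; ring.
- rewrite (_ : _ \o _ = quad (fun=> 0) (fun i => - (2 * v i))
    (fun i => - (2 * v i * t 0 i))); first exact: integrable_quad.
  by apply/funext => x; apply: eq_bigr => i _; rewrite !mxE; ring.
- move=> x y; rewrite euclid_norm_sqr /quad -big_split/=.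
  apply: ler_sum => i _; rewrite !mxE -subr_ge0 [leRHS](_ : _ =
    ((x : 'rV[R]_m) 0 i - (y : 'rV[R]_m) 0 i - v i) ^+ 2) ?sqr_ge0//.
  by ring.
- move=> w; rewrite euclid_norm_sqr /quad -big_split/=.
  by apply: eq_bigr => i _; rewrite !mxE /v; ring.
Qed.

(** In each coordinate the potentials come from (t x - s y)^2 / (s t) >= 0, an equality at x = s w,
    y = t w; positivity of the parameters gives the sign. The cost along the coupling is (s - t)^2
    w^2, whose integral brings in the marginal second moments. *)
Lemma W2_dilate mu (s t : 'rV[R]_m) : finite_second_moment mu ->
  positive_orthant R m s -> positive_orthant R m t ->
  fine (W2 (dilate mu s) (dilate mu t)) ^+ 2 =
  let S := dilation_scaling mu in
  ((s *m S - t *m S) *m (s *m S - t *m S)^T) 0 0.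
Proof.
move=> mu2 s0 t0.
rewrite /dilate (@W2_pushforward _ _ mu _ _
  (quad (fun i => 1 - t 0 i / s 0 i) (fun=> 0) (fun=> 0))
  (quad (fun i => 1 - s 0 i / t 0 i) (fun=> 0) (fun=> 0))).
- rewrite (eq_integral
    (fun x => (quad (fun i => (s 0 i - t 0 i) ^+ 2) (fun=> 0) (fun=> 0) x)%:E)).
    rewrite integral_quad// -mulmxBl mxE; apply: eq_bigr => i _.
    rewrite /dilation_scaling mul_mx_diag !mxE addr0 [RHS]mulrACA -!expr2.
    rewrite sqr_sqrtr//.
    by rewrite fine_ge0// integral_ge0// => x _; rewrite lee_fin sqr_ge0.
  move=> x _; congr EFin; rewrite euclid_norm_sqr; apply: eq_bigr => i _.
  by rewrite !mxE; ring.
- exact: measurable_quad.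
- exact: measurable_quad.
- rewrite (_ : _ \o _ = quad (fun i => (1 - t 0 i / s 0 i) * s 0 i ^+ 2)
    (fun=> 0) (fun=> 0)); first exact: integrable_quad.
  by apply/funext => x; apply: eq_bigr => i _; rewrite !mxE; ring.
- rewrite (_ : _ \o _ = quad (fun i => (1 - s 0 i / t 0 i) * t 0 i ^+ 2)
    (fun=> 0) (fun=> 0)); first exact: integrable_quad.
  by apply/funext => x; apply: eq_bigr => i _; rewrite !mxE; ring.
- move=> x y; rewrite euclid_norm_sqr /quad -big_split/=.
  apply: ler_sum => i _; rewrite !mxE.
  have si := s0 i; have ti := t0 i.
  rewrite -subr_ge0 [leRHS](_ : _ = (t 0 i * (x : 'rV[R]_m) 0 i -
    s 0 i * (y : 'rV[R]_m) 0 i) ^+ 2 / (s 0 i * t 0 i)).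
    by rewrite divr_ge0 ?sqr_ge0// mulr_ge0 ?ltW.
  by field; rewrite !gt_eqF.
- move=> w; rewrite euclid_norm_sqr /quad -big_split/=.
  apply: eq_bigr => i _; rewrite !mxE; have si := s0 i; have ti := t0 i.
  by field; rewrite !gt_eqF.
Qed.

End separable_quadratics.

Theorem corollary4p3 (R : realType) (m : nat) (mu0 : probability (Rvec R m) R)
    (mu0_W2 : finite_second_moment mu0) (mu0_discrete : discrete_measure mu0) :
  (forall (Theta : set 'rV[R]_m) (N : nat) (theta : 'I_N -> 'rV[R]_m),
     (forall i, Theta (theta i)) ->
     wassmap_recovers (fun i => translate mu0 (theta i)) theta) /\
  (forall (Theta : set 'rV[R]_m) (N : nat) (theta : 'I_N -> 'rV[R]_m),
     Theta `<=` positive_orthant R m ->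
     (forall i, Theta (theta i)) ->
     wassmap_recovers (fun i => dilate mu0 (theta i))
       (fun i => theta i *m dilation_scaling mu0)).
Proof.
split=> [ Theta N theta _ | Theta N theta Theta_gt0 theta_in].
  by apply: wassmap_recovers_isometric => i j; exact: W2_translate.
apply: wassmap_recovers_isometric => i j.
by apply: W2_dilate => //; exact: Theta_gt0.
Qed.
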